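(* Let $c,m,n$ be positive integers such that $m\le n-\frac12 n^{2/3}$. Then \[L_{c,m,n}\ge \lambda_3(c)\cdot\left(n-\tfrac12 n^{2/3}\right)\cdot\left(2e^3\right)^{\lfloor \frac12 n^{2/3}\rfloor},\] where $\lambda_3(c):=\dfrac{e^{-\frac{2\pi^2}{3}c-\frac{5}{12}}}{\pi^{3/2}c}$.
   Context: $L_{c,m,n}:=\mathrm{lcm}\{m^2+c,(m+1)^2+c,\dots,n^2+c\}$; $\lfloor t\rfloor$ denotes the floor of $t$. *)

(* Defs.v *)
From mathcomp Require Import all_boot all_order all_algebra.
From mathcomp Require Import all_classical all_reals all_analysis.

Set Implicit Arguments.
Unset Strict Implicit.
Unset Printing Implicit Defensive.

Import Order.TTheory GRing.Theory Num.Theory.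

Local Open Scope ring_scope.

Definition lcm_quad (c m n : nat) : nat :=
  \big[lcmn/1%N]_(m <= k < n.+1) (k ^ 2 + c)%N.

Definition lambda3 (R : realType) (c : nat) : R :=
  expR (- (2 * pi ^+ 2 / 3) * c%:R - 5 / 12) / (pi `^ (3 / 2) * c%:R).

(* Main.v *)
Require Import Defs.
From mathcomp Require Import all_boot all_order all_algebra all_field.
From mathcomp Require Import all_classical all_reals all_analysis.
From mathcomp Require Import ring lra zify.

Import Order.TTheory GRing.Theory Num.Theory.

Local Open Scope ring_scope.

(** Let w^2 = -c, and let L be a common multiple of the k^2 + c for
    l <= k <= l + h.  Expanding L / prod (k^2 + c) into partial fractions over
    the 2(h + 1) points k + w and k - w, each residue has a denominator dividing
    2 c h! prod_(1 <= j <= h) (j^2 + 4c) in Z[w], so that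

      prod_(l <= k <= l + h) (k^2 + c)  |  2 c h! prod_(1 <= j <= h) (j^2 + 4c) L.

    Take h = floor(n^(2/3) / 2) and l = n - h.  The product on the right is at
    most h!^2 exp(14 c / 3), and 14 / 3 < 2 pi^2 / 3.  On the left every factor is
    at least (n/2)^2, the last one n^2; with h!^2 <= e^2 h (h/e)^(2h) and
    8 h^3 <= n^2 this gives (2 e^3)^h times l, and the gap between 14 / 3 and
    2 pi^2 / 3 pays for the lost constants. *)

(** * Lagrange interpolation and partial fractions *)

(** The left side is the value at 0 of the polynomial [p] interpolating the constant 1 at the nodes
    [a i]: [p - 1] has degree below [#|I|] and vanishes at all [#|I|] nodes. *)
Lemma lagrange_one (F : fieldType) (I : finType) (a : I -> F) :
  (0 < #|I|)%N -> injective a ->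
  \sum_i \prod_(j | j != i) (a j / (a j - a i)) = 1.
Proof.
move=> I_gt0 a_inj.
have aB_neq0 i j : j != i -> a j - a i != 0.
  by move=> ji; rewrite subr_eq0 (inj_eq a_inj).
pose p : {poly F} := \sum_i \prod_(j | j != i) ((a j - a i)^-1 *: ((a j)%:P - 'X)).
have pE x : p.[x] = \sum_i \prod_(j | j != i) ((a j - x) / (a j - a i)).
  rewrite horner_sum; apply: eq_bigr => i _.
  rewrite horner_prod; apply: eq_bigr => j _.
  by rewrite !hornerE mulrC.
have p_a k : p.[a k] = 1.
  rewrite pE (bigD1 k) //= [X in _ + X]big1 ?addr0 => [|i ik].
    by apply: big1 => j jk; rewrite divff ?aB_neq0.
  by rewrite (bigD1 k) 1?eq_sym //= subrr !mul0r.
have size_p : (size (p - 1)%R <= #|I|)%N.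
  rewrite (leq_trans (size_polyD _ _)) // geq_max size_polyN size_poly1 I_gt0.
  rewrite andbT (leq_trans (size_sum _ _ _)) //; apply/bigmax_leqP => i _.
  have sum_le : (\sum_(j | j != i) size ((a j - a i)^-1 *: ((a j)%:P - 'X))
      <= #|[pred j | j != i]| * 2)%N.
    rewrite -sum_nat_const; apply: leq_sum => j _.
    rewrite (leq_trans (size_scale_leq _ _)) //.
    by rewrite -opprB size_polyN size_XsubC.
  have cardI : #|[pred j | j != i]|.+1 = #|I| by rewrite cardC1 prednK.
  rewrite (leq_trans (size_poly_prod_leq _ _)) //.
  rewrite leq_subLR -cardI addnS ltnS (leq_trans sum_le) // muln2 -addnn.
  exact: leqnn.
have p1 : p - 1 = 0.
  apply: contraTeq size_p => p_neq0; rewrite -ltnNge.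
  have := @max_poly_roots F (p - 1) (map a (enum I)) p_neq0.
  rewrite size_map -cardE; apply; last by rewrite map_inj_uniq ?enum_uniq.
  by apply/allP => _ /mapP [k _ ->]; rewrite rootE !hornerE p_a subrr.
have p0 : p.[0] = 1 by rewrite -[p](subrK 1) p1 add0r hornerE.
rewrite -[RHS]p0 pE; apply: eq_bigr => i _.
by apply: eq_bigr => j _; rewrite subr0.
Qed.

(** Multiplying the identity of [lagrange_one] by [d * l] turns its [i]-th term into [z i * y i]
    times the full product of the nodes. *)
Lemma Aint_dvd_prod (I : finType) (a : I -> algC) (d l : algC) :
  (0 < #|I|)%N -> injective a ->
  (forall i, exists2 z, z \in Aint & d = z * \prod_(j | j != i) (a j - a i)) ->
  (forall i, exists2 y, y \in Aint & l = a i * y) ->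
  exists2 x, x \in Aint & d * l = \prod_i a i * x.
Proof.
move=> I_gt0 a_inj /fin_all_exists2 [z zA dE] /fin_all_exists2 [y yA lE].
exists (\sum_i z i * y i); first by apply: rpred_sum => i _; rewrite rpredM.
rewrite -[LHS]mulr1 -[X in _ * X = _](@lagrange_one _ _ a) // !mulr_sumr.
apply: eq_bigr => i _.
rewrite [\prod_i a i](bigD1 i) //= {1}(dE i) {1}(lE i) big_split /= prodfV.
have : \prod_(j | j != i) (a j - a i) != 0.
  by apply/prodf_neq0 => j ji; rewrite subr_eq0 (inj_eq a_inj).
by move=> nz; field.
Qed.

(** * Denominators of the residues and the resulting divisibility *)

(** The factors with j < k, read backwards, are -(u + 1 + t); those with j > k are u + 1 - t. The
    values t = 0 and t = 2w serve for differences within one family of nodes and between the two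
    families. *)
Lemma prod_neq_shift (R : comNzRingType) (h : nat) (k : 'I_h.+1) (t : R) :
  \prod_(j < h.+1 | j != k) (j%:R - k%:R - t) =
  (-1) ^+ k * \prod_(0 <= u < k) (u.+1%:R + t)
    * \prod_(0 <= u < h - k) (u.+1%:R - t).
Proof.
have kh : (k <= h)%N by rewrite -ltnS.
rewrite -(big_mkord (fun j => j != k :> nat) (fun j => j%:R - k%:R - t)).
rewrite (@big_cat_nat _ _ _ k) //=; last exact: ltnW.
rewrite (@big_cat_nat _ _ _ k.+1 k) //=.
rewrite [\big[_/_]_(k <= _ < k.+1 | _) _]big_mkcond big_nat1 eqxx mul1r.
congr (_ * _).
  rewrite big_nat_rev /= add0n -[in X in (-1) ^+ X](subn0 k) -prodr_const_nat.
  rewrite -big_split /= big_mkcond /= big_nat_cond [RHS]big_nat_cond.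
  apply: eq_bigr => u; rewrite andbT => /andP[_ uk].
  have -> : (k - u.+1 != k)%N by lia.
  by rewrite natrB //; ring.
rewrite -{1}[k.+1]add0n big_addn subSS big_mkcond; apply: eq_bigr => u _.
have -> : (u + k.+1 != k)%N by lia.
by rewrite addnS -addSn natrD; ring.
Qed.

Lemma mul_Aint_prod_shift (c h : nat) (k : 'I_h.+1) (w : algC) :
  w ^+ 2 = - c%:R -> w \in Aint ->
  exists2 z, z \in Aint &
    (2 * c * h`! * \prod_(0 <= j < h) (j.+1 ^ 2 + 4 * c))%:R =
    z * (\prod_(j < h.+1 | j != k) (j%:R - k%:R) *
         \prod_(j < h.+1) (j%:R - k%:R - 2 * w)).
Proof.
move=> w2 wA; have kh : (k <= h)%N by rewrite -ltnS.
have cE : c%:R = - w ^+ 2 by rewrite w2 opprK.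
have natA n : n%:R \in Aint by rewrite Aint_Cnat.
pose t := 2 * w; have tA : t \in Aint by rewrite rpredM ?natA.
(* Each piece completes one factor: the binomial turns k! (h - k)! into h!, w turns the factor -2w
   at j = k into 2c, and the two products supply the missing j + 2w and j - 2w, where (j + 2w)(j -
   2w) = j^2 + 4c. *)
exists ('C(h, k)%:R * w * \prod_(k <= u < h) (u.+1%:R + t)
          * \prod_(h - k <= u < h) (u.+1%:R - t)).
  rewrite !rpredM ?natA //; apply: rpred_prod => u _.
    by rewrite rpredD ?natA.
  by rewrite rpredB ?natA.
have -> : \prod_(j < h.+1 | j != k) (j%:R - k%:R) =
    (-1) ^+ k * k`!%:R * (h - k)`!%:R :> algC.
  have factE n : \prod_(0 <= u < n) u.+1%:R = n`!%:R :> algC.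
    by rewrite fact_prod natr_prod big_add1.
  transitivity (\prod_(j < h.+1 | j != k) (j%:R - k%:R - 0) : algC).
    by apply: eq_bigr => j _; rewrite subr0.
  rewrite prod_neq_shift -!factE; congr (_ * _ * _).
    by apply: eq_bigr => u _; rewrite addr0.
  by apply: eq_bigr => u _; rewrite subr0.
rewrite [\prod_(j < h.+1) _](bigD1 k) //= prod_neq_shift -/t subrr sub0r.
rewrite natrM.
have -> : (\prod_(0 <= j < h) (j.+1 ^ 2 + 4 * c))%:R =
    \prod_(0 <= j < h) (j.+1%:R + t) * \prod_(0 <= j < h) (j.+1%:R - t) :> algC.
  rewrite -big_split /= natr_prod; apply: eq_bigr => j _.
  by rewrite natrD natrX natrM cE /t; ring.
rewrite [X in _ * (X * _) = _](@big_cat_nat _ _ _ k) //=.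
rewrite [X in _ * (_ * X) = _](@big_cat_nat _ _ _ (h - k)) ?leq_subr //=.
rewrite -(bin_fact kh) !natrM cE.
(* The sign (-1)^k arises once from each product of differences, so it cancels. *)
have s2 : (-1) ^+ k * (-1) ^+ k = 1 :> algC by rewrite -expr2 sqrr_sign.
move: ((-1) ^+ k) s2 => s s2.
transitivity (s * s * (2 * (- w ^+ 2) * ('C(h, k)%:R * (k`!%:R * (h - k)`!%:R))
 * (\prod_(0 <= u < k) (u.+1%:R + t) * \prod_(k <= u < h) (u.+1%:R + t)
 * (\prod_(0 <= u < h - k) (u.+1%:R - t) * \prod_(h - k <= u < h) (u.+1%:R - t))))).
  by rewrite s2 mul1r.
by rewrite /t; ring.
Qed.

Lemma prod_quad_dvd (c m h l : nat) : (0 < c)%N ->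
  (forall k, (m <= k <= m + h)%N -> (k ^ 2 + c %| l)%N) ->
  (\prod_(m <= k < (m + h).+1) (k ^ 2 + c) %|
     2 * c * h`! * \prod_(0 <= j < h) (j.+1 ^ 2 + 4 * c) * l)%N.
Proof.
move=> c_gt0 dvd_l.
have natA n : n%:R \in Aint by rewrite Aint_Cnat.
pose w : algC := sqrtC (- c%:R).
have w2 : w ^+ 2 = - c%:R by rewrite sqrtCK.
have wA : w \in Aint.
  apply: (@root_monic_Aint ('X^2 + c%:R%:P)).
  - by rewrite rootE !hornerE w2 addNr.
  - exact: monicXnaddC.
  - by rewrite polyOverXnaddC natr_int.
(* The two families of nodes never meet: (i - j)^2 >= 0, while (2w)^2 = -4c < 0. *)
have w_neq (i j : nat) : i%:R - j%:R != 2 * w.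
  apply/eqP => /(congr1 (fun x => x ^+ 2)) ij.
  have : 0 <= (i%:R - j%:R) ^+ 2 :> algC.
    by rewrite real_exprn_even_ge0 // rpredB ?realn.
  rewrite ij exprMn w2 mulrN oppr_ge0 -natrX -natrM lern0 muln_eq0.
  by rewrite (gtn_eqF c_gt0).
pose a (i : 'I_h.+1 + 'I_h.+1) : algC :=
  match i with inl k => (m + k)%:R + w | inr k => (m + k)%:R - w end.
have a_inj : injective a.
  case=> i [] j /=.
  - by move/addIr/eqP; rewrite eqr_nat eqn_add2l => /eqP/val_inj ->.
  - move=> e; case/negP: (w_neq (m + j)%N (m + i)%N).
    by rewrite -(addrK w (m + i)%:R) e; apply/eqP; ring.
  - move=> e; case/negP: (w_neq (m + i)%N (m + j)%N).
    by rewrite -(addrK w (m + j)%:R) -e; apply/eqP; ring.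
  - by move/addIr/eqP; rewrite eqr_nat eqn_add2l => /eqP/val_inj ->.
have aM (k : 'I_h.+1) : a (inl k) * a (inr k) = ((m + k) ^ 2 + c)%:R.
  by rewrite /= [RHS]natrD natrX -(opprK c%:R) -w2; ring.
have prod_a : \prod_i a i = (\prod_(m <= k < (m + h).+1) (k ^ 2 + c))%:R.
  rewrite big_sumType /= -big_split natr_prod -[X in index_iota X _]add0n big_addn /=.
  rewrite subSn ?leq_addr // addKn big_mkord; apply: eq_bigr => k _.
  by rewrite [(k + m)%N]addnC -aM.
have prod_nz : \prod_i a i != 0.
  rewrite prod_a pnatr_eq0 -lt0n prodn_gt0 // => k; by rewrite addn_gt0 c_gt0 orbT.
set d := (2 * c * _ * _)%N.
have [|i|i|x xA dlE] := @Aint_dvd_prod _ a d%:R l%:R _ a_inj.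
- by rewrite card_sum card_ord.
- case: i => k.
    have [z zA zE] := mul_Aint_prod_shift c h k w w2 wA.
    exists z => //; rewrite big_sumType /= zE; congr (_ * (_ * _)).
      by apply: eq_bigr => j _; rewrite !natrD; ring.
    by apply: eq_bigr => j _; rewrite !natrD; ring.
  (* Seen from a node k - w, the roles of w and -w are exchanged. *)
  have [||z zA zE] := mul_Aint_prod_shift c h k (- w); rewrite ?sqrrN ?rpredN //.
  exists z => //; rewrite big_sumType /= zE [X in _ = _ * X]mulrC; congr (_ * (_ * _)).
    by apply: eq_bigr => j _; rewrite !natrD; ring.
  by apply: eq_bigr => j _; rewrite !natrD; ring.
- have dvd_i (k : 'I_h.+1) : exists q, l%:R = ((m + k) ^ 2 + c)%:R * q%:R :> algC.
    have /dvdnP[q ->] : ((m + k) ^ 2 + c %| l)%N.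
      by rewrite dvd_l // leq_addr leq_add2l -ltnS ltn_ord.
    by exists q; rewrite mulnC natrM.
  case: i => k; have [q ->] := dvd_i k; rewrite -aM.
    exists (a (inr k) * q%:R); last by rewrite mulrA.
    by rewrite rpredM ?rpredB ?natA.
  exists (a (inl k) * q%:R); last by rewrite mulrA [_ * a (inr k)]mulrC.
  by rewrite rpredM ?rpredD ?natA.
(* The cofactor is an algebraic integer and also a quotient of natural numbers, hence itself a
   natural number. *)
have xE : x = (d * l)%:R / \prod_i a i by rewrite natrM dlE mulrC mulKf.
have : x \is a Num.nat.
  rewrite natrEint {2}xE prod_a divr_ge0 // andbT.
  by apply: Cint_rat_Aint => //; rewrite xE prod_a rpred_div ?rpred_nat.
case/natrP => q xq; apply/dvdnP; exists q.
by apply/eqP; rewrite -(eqr_nat algC) natrM dlE xq prod_a -natrM mulnC.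
Qed.

(** * Elementary estimates for exp and pi *)

(** The function [f] vanishes at 0 and its derivative [df] is nonnegative for x >= 0; then f(y) >= 0
    is multiplied by exp(y). *)
Lemma expR2_le (R : realType) (y : R) :
  0 <= y < 1 -> expR (2 * y) <= (1 + y) / (1 - y).
Proof.
move=> /andP[y0 y1].
pose f (x : R) := expR (- x) * (1 + x) - expR x * (1 - x).
pose df (x : R) := x * (expR x - expR (- x)).
have fD x : is_derive x (1 : R) f (df x).
  apply: is_derive_eq.
  by rewrite /df /GRing.scale /=; ring.
have fC : {within `[0, y], continuous f}%classic.
  apply: derivable_within_continuous => x _; exact: ex_derive.
have [x /[!in_itv]/= /andP[x0 _]] := MVT_segment y0 (fun x _ => fD x) fC.
have f0 : f 0 = 0 by rewrite /f oppr0; ring.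
rewrite f0 !subr0 => fy.
have : 0 <= f y.
  by rewrite fy /df mulr_ge0 // mulr_ge0 // subr_ge0 ler_expR; lra.
rewrite /f subr_ge0 ler_pdivlMr ?subr_gt0 // => le_exp.
rewrite mulr_natl mulr2n expRD -mulrA.
have -> : 1 + y = expR y * (expR (- y) * (1 + y)).
  by rewrite mulrA expRxMexpNx_1 mul1r.
by rewrite ler_wpM2l ?expR_ge0.
Qed.

Lemma sin_le_id (R : realType) (x : R) : 0 <= x -> sin x <= x.
Proof.
move=> x0.
have [|t _] := MVT_segment x0 (fun t _ => is_derive_sin t).
  by apply: derivable_within_continuous => t _; exact: ex_derive.
by rewrite sin0 !subr0 => ->; rewrite ler_piMl ?cos_le1.
Qed.

(** From sin(pi/4)^2 = 1/2 and sin(pi/4) <= pi/4. It yields 2 pi^2 / 3 >= 16/3 > 14/3. *)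
Lemma pi_sqr_ge8 (R : realType) : 8 <= pi ^+ 2 :> R.
Proof.
have := tan_piquarter R; rewrite /tan => tan1.
have cos_neq0 : cos (pi / 4) != 0 :> R.
  by apply: contra_eq_neq tan1 => ->; rewrite invr0 mulr0 eq_sym oner_neq0.
have sincos : sin (pi / 4) = cos (pi / 4) :> R.
  by rewrite -[LHS](divfK cos_neq0) tan1 mul1r.
have := cos2Dsin2 (pi / 4 : R); rewrite -sincos => sin2.
have pi0 := pi_gt0 R.
have sin_le : sin (pi / 4) <= pi / 4 :> R by apply: sin_le_id; lra.
have sin_ge : 0 <= sin (pi / 4) :> R by apply: sin_ge0_pi; lra.
nra.
Qed.

(** Taking y = 1/3 in [expR2_le] gives exp(2/3) <= 2, which is then cubed. *)
Lemma expR1_sqr_le8 (R : realType) : expR 1 ^+ 2 <= 8 :> R.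
Proof.
have : expR (2 * 3^-1) <= 2 :> R.
  apply: (le_trans (@expR2_le R 3^-1 _)); first by apply/andP; split; lra.
  by rewrite ler_pdivrMr; lra.
move=> /(lerXn2r 3); rewrite !nnegrE expR_ge0 => /(_ isT (ler0n _ 2)).
have -> : expR (2 * 3^-1) ^+ 3 = expR 1 ^+ 2 :> R.
  by rewrite -!expRM_natl; congr expR; lra.
by move/le_trans; apply; lra.
Qed.

(** * Upper bounds for the factorial and for the product of the j^2 + 4c *)

(** A Stirling bound by induction, sharp at h = 1. The step from k to k + 1 amounts to e^2 <= (1 +
    1/k)^(2k + 1). *)
Lemma fact_sqr_le (R : realType) (h : nat) : (0 < h)%N ->
  h`!%:R ^+ 2 * expR 1 ^+ (2 * h) <= expR 1 ^+ 2 * h%:R ^+ (2 * h).+1 :> R.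
Proof.
case: h => // h _; elim: h => [|h IH].
  by rewrite (_ : 1`! = 1)%N // !expr1n mul1r mulr1.
have e0 : 0 < expR 1 :> R by exact: expR_gt0.
have h0 : 0 < h.+1%:R :> R by rewrite ltr0n.
have step : expR 1 ^+ 2 * h.+1%:R ^+ (2 * h.+1).+1
            <= h.+2%:R ^+ (2 * h.+1).+1 :> R.
  have p0 : 0 < (2 * h.+1).+1%:R :> R by rewrite ltr0n.
  (* With k = h + 1, this y = 1/(2k + 1) satisfies (1 + y)/(1 - y) = (k + 1)/k and 2y (2k + 1) =
     2. *)
  pose y : R := (2 * h.+1).+1%:R^-1.
  have y_itv : 0 <= y < 1.
    by rewrite invr_ge0 ltW //= invf_lt1 // ltr1n.
  have yE : (1 + y) / (1 - y) = h.+2%:R / h.+1%:R.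
    rewrite /y; move: p0 h0; rewrite -natr1 -[h.+2%:R]natr1 natrM.
    by move=> p0 h0; field; rewrite !lt0r_neq0 //; lra.
  have := @expR2_le R y y_itv; rewrite yE => /(lerXn2r (2 * h.+1).+1).
  rewrite !nnegrE expR_ge0 divr_ge0 // => /(_ isT isT).
  rewrite expr_div_n ler_pdivlMr ?exprn_gt0 //.
  suff -> : expR 1 ^+ 2 = expR (2 * y) ^+ (2 * h.+1).+1 by [].
  by rewrite -!expRM_natl; congr expR; rewrite mulrCA mulfV ?lt0r_neq0.
rewrite factS natrM exprMn mulnS exprD.
rewrite (_ : _ * _ = (h.+2%:R ^+ 2 * expR 1 ^+ 2)
  * (h.+1`!%:R ^+ 2 * expR 1 ^+ (2 * h.+1))); last by ring.
apply: (@le_trans _ _ (h.+2%:R ^+ 2 * expR 1 ^+ 2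
  * (expR 1 ^+ 2 * h.+1%:R ^+ (2 * h.+1).+1))).
  by rewrite ler_wpM2l // mulr_ge0 ?exprn_ge0 // ltW.
rewrite -[(2 + _).+1]addnS exprD [_ * expR 1 ^+ 2]mulrC -[leLHS]mulrA.
by rewrite ler_wpM2l ?exprn_ge0 ?ler_wpM2l ?exprn_ge0 // ltW.
Qed.

(* By induction, the exponent 14/3 being replaced by 14/3 - 4/(h + 1/2):
   1/k^2 <= 1/(k - 1/2) - 1/(k + 1/2), and 1 + 4c <= exp(2c) starts it. *)
Lemma prod_quad_le (R : realType) (c h : nat) : (0 < c)%N ->
  (\prod_(0 <= j < h) (j.+1 ^ 2 + 4 * c))%:R
    <= h`!%:R ^+ 2 * expR (14 / 3 * c%:R) :> R.
Proof.
move=> c_gt0; have c1 : 1 <= c%:R :> R by rewrite ler1n.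
case: h => [|h].
  rewrite big_geq // expr1n mul1r; apply: le_trans (expR_ge1Dx _); lra.
suff : (\prod_(0 <= j < h.+1) (j.+1 ^ 2 + 4 * c))%:R <=
    h.+1`!%:R ^+ 2 * expR ((14 / 3 - 4 / (h.+1%:R + 2^-1)) * c%:R) :> R.
  move/le_trans; apply; rewrite ler_wpM2l ?exprn_ge0 // ler_expR.
  rewrite ler_wpM2r // ?lerBlDr ?lerDl ?divr_ge0 ?addr_ge0 //; lra.
elim: h => [|h IH].
  rewrite big_nat1 expr1n mul1r.
  have -> : (14 / 3 - 4 / (1 + 2^-1)) * c%:R = 2 * c%:R :> R by field.
  (* The tangent bound 1 + 2c for exp(2c) is too weak; applied to exp(c/2) and raised to the fourth
     power it exceeds 1 + 4c, since c <= c^2 and c <= c^3. *)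
  have -> : expR (2 * c%:R) = expR (c%:R / 2) ^+ 4 :> R.
    by rewrite -expRM_natl; congr expR; lra.
  apply: le_trans (_ : (1 + c%:R / 2) ^+ 4 <= _); last first.
    by rewrite lerXn2r ?expR_ge1Dx // nnegrE ?expR_ge0 //; lra.
  rewrite natrD natrM natrX; move: c1; set x : R := c%:R => x1.
  have x2 : x <= x ^+ 2 by nra.
  have x3 : x <= x ^+ 3 by nra.
  rewrite -subr_ge0.
  have -> : (1 + x / 2) ^+ 4 - (1%:R ^+ 2 + 4%:R * x) =
    3 / 2 * (x ^+ 2 - x) + 2^-1 * (x ^+ 3 - x) + x ^+ 4 / 16 by field.
  by rewrite !addr_ge0 ?mulr_ge0 ?subr_ge0 ?exprn_ge0 //; lra.
have k0 : 0 < h.+2%:R :> R by rewrite ltr0n.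
rewrite big_nat_recr //= natrM [h.+2`!]factS natrM exprMn.
have h1 : h.+1%:R = h.+2%:R - 1 :> R by rewrite -[h.+2%:R]natr1 addrK.
have k2 : 2 <= h.+2%:R :> R by rewrite ler_nat.
have factor : (h.+2 ^ 2 + 4 * c)%:R <=
    h.+2%:R ^+ 2 * expR (4 * c%:R / h.+2%:R ^+ 2) :> R.
  rewrite mulrC -ler_pdivrMr ?exprn_gt0 //.
  apply: le_trans (expR_ge1Dx _); rewrite natrD natrX natrM mulrDl.
  by rewrite divff // lt0r_neq0 // exprn_gt0.
apply: (le_trans (ler_pM _ _ IH factor)) => //.
rewrite mulrACA -expRD [_ ^+ 2 * _ ^+ 2]mulrC ler_wpM2l ?mulr_ge0 ?exprn_ge0 //.
rewrite ler_expR h1; move: k0 k2; set k : R := h.+2%:R => k0 k2.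
rewrite [4 * _ / _]mulrAC -mulrDl ler_wpM2r //.
have -> : 14 / 3 - 4 / (k - 1 + 2^-1) + 4 / k ^+ 2 =
   14 / 3 - 4 / (k + 2^-1) - (k ^+ 2 * (k ^+ 2 - 4^-1))^-1.
  by field; rewrite !lt0r_neq0 //; nra.
rewrite lerBlDr lerDl invr_ge0 mulr_ge0 ?exprn_ge0 //; nra.
Qed.

(** * The product of squares from below, the cube of the factorial from above *)

(** With n = m + h + 1, the first factor m^2 and the last factor n^2 = 4 (n/2)^2 are kept exactly;
    only the h factors between them are bounded by (n/2)^2, as n <= 2m. *)
Lemma prod_sqr_ge (R : realType) (m h : nat) : (h.+1 <= m)%N ->
  4 * m%:R ^+ 2 * ((m + h.+1)%:R / 2) ^+ (2 * h.+1)
    <= \prod_(m <= k < (m + h.+1).+1) k%:R ^+ 2 :> R.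
Proof.
move=> hm; set n : R := (m + h.+1)%:R; have n0 : 0 <= n by exact: ler0n.
have n2 : 0 <= n / 2 by lra.
have mn : (m < m + h.+1)%N by lia.
rewrite big_nat_recr ?leq_addr //= big_ltn //.
rewrite mulnS exprD exprM.
have mid : (n / 2) ^+ 2 ^+ h <= \prod_(m.+1 <= k < m + h.+1) k%:R ^+ 2.
  have hE : (m + h.+1 - m.+1)%N = h by lia.
  rewrite -[X in _ ^+ X <= _]hE -prodr_const_nat big_nat_cond [leRHS]big_nat_cond.
  apply: ler_prod => k; rewrite andbT => /andP[mk kn].
  rewrite exprn_ge0 //= lerXn2r ?nnegrE // /n ler_pdivrMr // -natrM ler_nat.
  by lia.
rewrite [leLHS](_ : _ = m%:R ^+ 2 * (n / 2) ^+ 2 ^+ h * n ^+ 2); last by field.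
by rewrite ler_wpM2r ?exprn_ge0 // ler_wpM2l ?exprn_ge0.
Qed.

(** Both sides are squared, so that the cube of [fact_sqr_le] applies. The power 8^(2h + 1) then
    combines with h^(3(2h + 1)) into (8 h^3)^(2h + 1); its odd exponent is the source of the square
    root of 8. *)
Lemma fact_cube_le (R : realType) (h : nat) (x : R) : (0 < h)%N -> 0 <= x ->
  8 * h%:R ^+ 3 <= x ^+ 2 ->
  h`!%:R ^+ 3 * expR 1 ^+ (3 * h) * 8 ^+ h * Num.sqrt 8
    <= expR 1 ^+ 3 * x ^+ (2 * h).+1.
Proof.
move=> h_gt0 x0 hx.
have e0 : 0 <= expR 1 :> R by exact: expR_ge0.
rewrite -(@ler_pXn2r _ 2) ?nnegrE ?mulr_ge0 ?exprn_ge0 ?sqrtr_ge0 //.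
have -> : (h`!%:R ^+ 3 * expR 1 ^+ (3 * h) * 8 ^+ h * Num.sqrt 8) ^+ 2 =
   (h`!%:R ^+ 2 * expR 1 ^+ (2 * h)) ^+ 3 * 8 ^+ (2 * h).+1 :> R.
  rewrite exprMn sqr_sqrtr // [8 ^+ _.+1]exprS ![(_ * h)%N]mulnC !exprM.
  by move: (_ ^+ h) (8 ^+ h) => *; ring.
have le3 := lerXn2r 3 _ _ (@fact_sqr_le R h h_gt0).
apply: (@le_trans _ _ ((expR 1 ^+ 2 * h%:R ^+ (2 * h).+1) ^+ 3 * 8 ^+ (2 * h).+1)).
  by rewrite ler_wpM2r ?exprn_ge0 // le3 // nnegrE ?mulr_ge0 ?exprn_ge0.
have -> : (expR 1 ^+ 2 * h%:R ^+ (2 * h).+1) ^+ 3 * 8 ^+ (2 * h).+1 =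
    expR 1 ^+ 6 * (8 * h%:R ^+ 3) ^+ (2 * h).+1 :> R.
  rewrite [in RHS]exprMn [_ ^+ 3 ^+ _]exprAC.
  by move: (h%:R ^+ _) (8 ^+ _) => *; ring.
have -> : (expR 1 ^+ 3 * x ^+ (2 * h).+1) ^+ 2 =
    expR 1 ^+ 6 * (x ^+ 2) ^+ (2 * h).+1.
  by rewrite [in RHS]exprAC; move: (x ^+ _) => *; ring.
by rewrite ler_wpM2l ?exprn_ge0 // lerXn2r // nnegrE ?mulr_ge0 ?exprn_ge0.
Qed.

(** * The constant [lambda3] *)

(** The exponentials combine to exponent (14/3 - 2 pi^2 / 3) c + 31/12 <= 31/12 - 2/3 < 2. Now e^2
    <= 8, and pi^(3/2) >= pi >= sqrt 8 absorbs one of the two factors sqrt 8. *)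
Lemma lambda3_le (R : realType) (c : nat) : (0 < c)%N ->
  lambda3 R c * (c%:R * expR (14 / 3 * c%:R) * expR 1 ^+ 3) <= Num.sqrt 8.
Proof.
move=> c_gt0; have c1 : 1 <= c%:R :> R by rewrite ler1n.
have pi8 := pi_sqr_ge8 R; have pi2 := pi_ge2 R.
have s0 : 0 <= Num.sqrt 8 :> R by exact: sqrtr_ge0.
have s2 : Num.sqrt 8 ^+ 2 = 8 :> R by rewrite sqr_sqrtr.
have pi_pow : Num.sqrt 8 <= pi `^ (3 / 2) :> R.
  apply: (@le_trans _ _ pi); last by apply: le1r_powR; lra.
  by rewrite -(@ler_pXn2r _ 2) ?nnegrE ?s2 //; lra.
have pow0 : 0 < pi `^ (3 / 2) :> R by apply: powR_gt0; lra.
rewrite /lambda3 (_ : _ * _ = expR (- (2 * pi ^+ 2 / 3) * c%:R - 5 / 12)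
   * expR (14 / 3 * c%:R) * expR 1 ^+ 3 / pi `^ (3 / 2)); last first.
  by field; rewrite !lt0r_neq0 // (lt_le_trans ltr01).
rewrite ler_pdivrMr // -expRM_natl -!expRD.
apply: (@le_trans _ _ (Num.sqrt 8 ^+ 2)); last by rewrite expr2 ler_wpM2l.
rewrite s2; apply: le_trans (expR1_sqr_le8 R).
rewrite -expRM_natl ler_expR; nra.
Qed.

Lemma lambda3_ge0 (R : realType) (c : nat) : 0 <= lambda3 R c.
Proof. by rewrite divr_ge0 ?expR_ge0 // mulr_ge0 ?powR_ge0. Qed.

(** Serves the case h = 0: the factor [M] multiplying [lambda3] in [lambda3_le] is at least 3 >=
    sqrt 8. *)
Lemma lambda3_le1 (R : realType) (c : nat) : (0 < c)%N -> lambda3 R c <= 1.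
Proof.
move=> c_gt0; have c1 : 1 <= c%:R :> R by rewrite ler1n.
have e2 : 2 <= expR 1 :> R by apply: le_trans (expR_ge1Dx 1); lra.
have E1 : 1 <= expR (14 / 3 * c%:R) :> R.
  by apply: le_trans (expR_ge1Dx _); lra.
have s3 : Num.sqrt 8 <= 3 :> R.
  by rewrite -(@ler_pXn2r _ 2) ?nnegrE ?sqr_sqrtr ?sqrtr_ge0 //; lra.
have := @lambda3_le R c c_gt0; set M := c%:R * _ * _ => le_M.
have M3 : 3 <= M.
  rewrite /M -[leLHS]mul1r ler_pM //; first by rewrite -[leLHS]mul1r ler_pM.
  by apply: (@le_trans _ _ (2 ^+ 3)); [lra | rewrite lerXn2r ?nnegrE ?expR_ge0].
have : lambda3 R c * M <= 1 * M by lra.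
by rewrite ler_pM2r //; lra.
Qed.

(** * From divisibility to a lower bound for the lcm *)

Lemma dvdn_lcm_quad (c m n k : nat) :
  (m <= k <= n)%N -> (k ^ 2 + c %| lcm_quad c m n)%N.
Proof.
move=> mkn; rewrite /lcm_quad (@bigD1_seq _ _ _ _ _ k) ?iota_uniq //=.
  exact: dvdn_lcml.
by rewrite mem_index_iota ltnS.
Qed.

Lemma lcm_quad_gt0 (c m n : nat) : (0 < c)%N -> (0 < lcm_quad c m n)%N.
Proof.
move=> c_gt0; apply: (big_ind (fun x => 0 < x)%N) => // [x y x0 y0|k _].
  by rewrite lcmn_gt0 x0.
by rewrite addn_gt0 c_gt0 orbT.
Qed.

(** [prod_quad_dvd] read as an inequality. One h! is already in the multiplier, the other two come
    from [prod_quad_le]. *)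
Lemma prod_sqr_le_lcm_quad (R : realType) (c m l h : nat) :
  (0 < c)%N -> (m <= l)%N ->
  \prod_(l <= k < (l + h).+1) k%:R ^+ 2 <=
  2 * c%:R * h`!%:R ^+ 3 * expR (14 / 3 * c%:R)
    * (lcm_quad c m (l + h))%:R :> R.
Proof.
move=> c_gt0 ml; set L := lcm_quad c m (l + h).
have L0 : (0 < L)%N by exact: lcm_quad_gt0.
pose Q := (\prod_(0 <= j < h) (j.+1 ^ 2 + 4 * c))%N.
have Q0 : (0 < Q)%N.
  by rewrite prodn_gt0 // => j; rewrite addn_gt0 expn_gt0.
have /dvdn_leq : (\prod_(l <= k < (l + h).+1) (k ^ 2 + c) %|
    2 * c * h`! * Q * L)%N.
  apply: prod_quad_dvd => // k /andP[lk kh]; apply: dvdn_lcm_quad.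
  by rewrite kh andbT (leq_trans ml).
rewrite !muln_gt0 c_gt0 fact_gt0 Q0 L0 => /(_ isT).
rewrite -(ler_nat R) => le_prod.
apply: (@le_trans _ _ (\prod_(l <= k < (l + h).+1) (k ^ 2 + c))%:R).
  rewrite natr_prod; apply: ler_prod => k _.
  by rewrite exprn_ge0 //= natrD natrX lerDl.
apply: (le_trans le_prod); rewrite !natrM.
rewrite [leRHS](_ : _ = 2 * c%:R * h`!%:R
  * (h`!%:R ^+ 2 * expR (14 / 3 * c%:R)) * L%:R); last by ring.
by rewrite ler_wpM2r // ler_wpM2l // ?mulr_ge0 // prod_quad_le.
Qed.

Lemma lcm_quad_ge (R : realType) (c m l h : nat) :
  (0 < c)%N -> (0 < h)%N -> (m <= l)%N -> (h <= l)%N ->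
  8 * h%:R ^+ 3 <= (l + h)%:R ^+ 2 :> R ->
  lambda3 R c * l%:R * (2 * expR 1 ^+ 3) ^+ h
    <= (lcm_quad c m (l + h))%:R.
Proof.
move=> c_gt0 h_gt0 ml hl hn.
have l0 : 0 < l%:R :> R by rewrite ltr0n; lia.
have c0 : 0 < c%:R :> R by rewrite ltr0n.
have le_lcm := @prod_sqr_le_lcm_quad R c m l h c_gt0 ml.
have prod_ge : 4 * l%:R ^+ 2 * ((l + h)%:R / 2) ^+ (2 * h)
    <= \prod_(l <= k < (l + h).+1) k%:R ^+ 2 :> R.
  by case: h h_gt0 hl {hn le_lcm} => // h _; exact: prod_sqr_ge.
have fact_le := @fact_cube_le R h (l + h)%:R h_gt0 (ler0n _ _) hn.
have lambda_le := @lambda3_le R c c_gt0.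
have n_le : (l + h)%:R <= 2 * l%:R :> R by rewrite -natrM ler_nat; lia.
have lam0 := lambda3_ge0 R c.
have n0 : 0 < (l + h)%:R :> R by rewrite ltr0n; lia.
have E0 : 0 < expR (14 / 3 * c%:R) :> R by exact: expR_gt0.
have e0 : 0 < expR 1 :> R by exact: expR_gt0.
have s0 : 0 < Num.sqrt 8 :> R by rewrite sqrtr_gt0.
move: (lcm_quad _ _ _)%:R (ler0n R (lcm_quad c m (l + h))) le_lcm => L L0 le_lcm.
move: prod_ge fact_le n_le n0; set n : R := (l + h)%:R; set e := expR 1.
set E := expR _ in lambda_le le_lcm E0 *; set s := Num.sqrt 8 in s0 lambda_le *.
move=> prod_ge fact_le n_le n0.
(* The lower and upper bounds for the product of squares are multiplied by e^(3h) 8^h s. Of 8^h =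
   2^h 4^h, the part 4^h clears the denominator of (n/2)^(2h) and 2^h goes into (2 e^3)^h; [fact_le]
   then removes h!^3. *)
have step1 : 4 * l%:R ^+ 2 * s * (2 * e ^+ 3) ^+ h * n ^+ (2 * h) <=
    2 * c%:R * E * L * e ^+ 3 * n * n ^+ (2 * h).
  apply: (@le_trans _ _ (2 * c%:R * h`!%:R ^+ 3 * E * L * (e ^+ (3 * h) * 8 ^+ h * s))).
    rewrite [leLHS](_ : _ = 4 * l%:R ^+ 2 * (n / 2) ^+ (2 * h)
      * (e ^+ (3 * h) * 8 ^+ h * s)).
      rewrite ler_wpM2r ?(le_trans prod_ge) //.
      by rewrite !mulr_ge0 ?exprn_ge0 ?(ltW e0) ?(ltW s0).
    have -> : (2 * e ^+ 3) ^+ h = 2 ^+ h * e ^+ (3 * h) by rewrite exprMn exprM.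
    have -> : 8 ^+ h = 2 ^+ h * 2 ^+ (2 * h) :> R.
      by rewrite exprM -exprMn; congr (_ ^+ h); ring.
    have two0 : 2 ^+ (2 * h) != 0 :> R by rewrite expf_neq0.
    by rewrite expr_div_n; field.
  rewrite [leLHS](_ : _ = 2 * c%:R * E * L *
     (h`!%:R ^+ 3 * e ^+ (3 * h) * 8 ^+ h * s)); last by ring.
  rewrite [leRHS](_ : _ = 2 * c%:R * E * L * (e ^+ 3 * n ^+ (2 * h).+1)).
    by rewrite ler_wpM2l // !mulr_ge0 // ltW.
  by rewrite (exprSr _ (2 * h)); ring.
move: step1; rewrite ler_pM2r ?exprn_gt0 // => step1.
have M0 : 0 < c%:R * E * e ^+ 3 by rewrite !mulr_gt0 ?exprn_gt0.
have D0 : 0 <= (2 * e ^+ 3) ^+ h by rewrite exprn_ge0 // mulr_ge0 ?exprn_ge0 ?(ltW e0).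
(* One factor l is spent on n <= 2l, and 4l is cancelled. *)
have step2 : l%:R * s * (2 * e ^+ 3) ^+ h <= c%:R * E * e ^+ 3 * L.
  have : (4 * l%:R) * (l%:R * s * (2 * e ^+ 3) ^+ h)
      <= (4 * l%:R) * (c%:R * E * e ^+ 3 * L).
    have -> : 4 * l%:R * (l%:R * s * (2 * e ^+ 3) ^+ h) =
      4 * l%:R ^+ 2 * s * (2 * e ^+ 3) ^+ h by ring.
    apply: (le_trans step1).
    rewrite [leLHS](_ : _ = 2 * (c%:R * E * e ^+ 3 * L) * n); last by ring.
    rewrite [leRHS](_ : _ = 2 * (c%:R * E * e ^+ 3 * L) * (2 * l%:R)); last by ring.
    by rewrite ler_wpM2l // !mulr_ge0 // ltW.
  by rewrite ler_pM2l // mulr_gt0.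
(* By [lambda3_le], [lambda3] times the lost constants is at most s = sqrt 8. *)
rewrite -(ler_pM2l M0); apply: le_trans step2.
rewrite [leLHS](_ : _ = lambda3 R c * (c%:R * E * e ^+ 3) * (l%:R * (2 * e ^+ 3) ^+ h)).
  rewrite [leRHS](_ : _ = s * (l%:R * (2 * e ^+ 3) ^+ h)); last by ring.
  by rewrite ler_wpM2r // mulr_ge0 // ltW.
by ring.
Qed.

(** * The choice of h and the conclusion *)

Theorem theorem5 (R : realType) (c m n : nat)
  (c_gt0 : (0 < c)%N) (m_gt0 : (0 < m)%N) (n_gt0 : (0 < n)%N)
  (le_mn : m%:R <= n%:R - 2^-1 * n%:R `^ (2 / 3) :> R) :
  lambda3 R c * (n%:R - 2^-1 * n%:R `^ (2 / 3))
    * (2 * expR 1 ^+ 3) ^ Num.floor (2^-1 * n%:R `^ (2 / 3) : R)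
  <= (lcm_quad c m n)%:R.
Proof.
move: le_mn; set y : R := 2^-1 * _ => le_mn.
have n1 : 1 <= n%:R :> R by rewrite ler1n.
have y0 : 0 <= y by rewrite mulr_ge0 ?powR_ge0.
have y3 : 8 * y ^+ 3 = n%:R ^+ 2.
  rewrite exprMn -(powR_mulrn 3 (powR_ge0 _ _)) -powRrM.
  have -> : 2 / 3 * 3%:R = 2%:R :> R by lra.
  by rewrite powR_mulrn //; field.
have /andP[hy yh] := truncn_itv y0; set h := Num.truncn y in hy yh.
have -> : Num.floor y = h.
  by apply: floor_def; rewrite intrD -!pmulrn natr1 hy yh.
have m1 : 1 <= m%:R :> R by rewrite ler1n.
have hn : 8 * h%:R ^+ 3 <= n%:R ^+ 2 :> R.
  by rewrite -y3 ler_pM2l // lerXn2r ?nnegrE.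
(* From (2h)^3 <= n^2 <= n^3; this is h <= l for l = n - h. *)
have h2n : (2 * h <= n)%N.
  have two3 : 2 ^+ 3 = 8 :> R by ring.
  rewrite -(ler_nat R) -(@ler_pXn2r _ 3) ?nnegrE // natrM exprMn two3.
  by rewrite (le_trans hn) // ler_weXn2l.
have mh : (m + h <= n)%N by rewrite -(ler_nat R) natrD; lra.
have lam0 := lambda3_ge0 R c.
(* For h = 0 the power is 1, and n <= n^2 + c, a divisor of the lcm, suffices. *)
case: (posnP h) => [h_eq0|h_gt0].
  rewrite h_eq0 expr0z mulr1; apply: (@le_trans _ _ n%:R).
    rewrite -[leRHS]mul1r ler_pM ?lambda3_le1 //; lra.
  rewrite ler_nat; apply: (@leq_trans (n ^ 2 + c)%N).
    by rewrite -mulnn; nia.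
  by rewrite dvdn_leq ?lcm_quad_gt0 // dvdn_lcm_quad // leqnn andbT; lia.
rewrite -exprnP; have nE : (n - h + h)%N = n by lia.
(* As h <= y, replacing n - y by the integer n - h only enlarges the left side. *)
apply: (@le_trans _ _ (lambda3 R c * (n - h)%:R * (2 * expR 1 ^+ 3) ^+ h)).
  rewrite ler_wpM2r ?exprn_ge0 ?mulr_ge0 ?exprn_ge0 ?expR_ge0 //.
  by rewrite ler_wpM2l // natrB; [lra | lia].
by rewrite -[in leRHS]nE lcm_quad_ge ?nE //; lia.
Qed.
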